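(* Let $D$ be a Go-diagram in a partition $\lambda\in\Lambda_{k,n}$. Let $\mathcal R_D$ be the set of matrices $R_D$ (the $k\times n$ restricted path matrices of $D$) obtained when the jump parameters $\beta_b$ at cells with $\bullet$ vary over $\mathbb F$, the jump parameters at cells with $+$ vary over $\mathbb F^*$, and the jump parameters at cells with $\circ$ are set to $0$. Then each matrix in $\mathcal R_D$ realizes a point in the Deodhar component $\mathcal D_D$, and each point in $\mathcal D_D$ is realized by a unique matrix in $\mathcal R_D$.
   Context: **Partitions and pipe dreams.** Let $k\le n$ be natural numbers. $\Lambda_{k,n}$ is the set of partitions $\lambda=(\lambda_1\ge\dots\ge\lambda_k\ge 0)$ with $\lambda_1\le n-k$; $\lambda$ is identified with its Young diagram (English notation) in the top-left corner of a rectangle with $k$ rows and $n-k$ columns. The south-east border of $\lambda$ is the lattice path from the north-east corner to the south-west corner of the rectangle bounding $\lambda$; its $n$ unit edges are labelled $1,\dots,n$ starting from the north-east end. The north-west border consists of the top side of the rectangle ($n-k$ edges, the north boundary) and its left side ($k$ edges, the west boundary). A pipe dream on $\lambda$ is a filling of every cell by a crossing tile or an elbow tile. Pipe $j$ starts at the south-east border edge labelled $j$ and travels to the north-west border: it enters each cell through its east or south edge; in a crossing tile east continues to west and south continues to north; in an elbow tile east turns to north and south turns to west. Each edge of the north-west border is labelled by the index of the pipe exiting there. Given a pipe dream, write $+$ in each elbow cell; in a crossing cell write $\circ$ (white stone) if the pipe entering from the east has the smaller index of the two pipes, and $\bullet$ (black stone) if the pipe entering from the east has the larger index. A pipe dream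 is a Go-diagram if in no elbow cell the pipe entering from the east has larger index than the pipe entering from the south. $D(b)$ denotes the symbol at cell $b$. **Restricted paths.** Vertices are attached to all labels on the two borders; those on the north-west border are sources, those on the south-east border are sinks. A restricted path goes from a source to a sink along the pipes (traversed from the north-west border towards the south-east border), following the pipe it is on, except that upon entering a cell with $+$ or $\bullet$ it may alternatively jump to the other pipe of that cell provided that pipe has the lower index (it then continues along that pipe). A cell where it changes pipes is a jump site. A jump parameter $\beta_b$ is attached to each cell $b$; the weight $\mathrm{wt}(P)$ of a restricted path $P$ is the product of the jump parameters at its jump sites. Put $(\tilde R_D)_{st}=\sum_{P:s\to t}\mathrm{wt}(P)$, an $n\times n$ matrix, the sum being over restricted paths from the source labelled $s$ to the sink labelled $t$. If $v_1,\dots,v_k$ are the labels on the west boundary from top to bottom, $R_D$ is the $k\times n$ matrix $(R_D)_{st}=(\tilde R_D)_{v_s t}$. **Deodhar components.** $\mathbb F$ is $\mathbb R$ or $\mathbb C$, $\mathbb F^*=\mathbb F\setminus\{0\}$. $Gr_{k,n}$ is the Grassmannian of $k$-dimensional subspaces of $\mathbb F^n$; a $k\times n$ matrix realizes $V$ if its rows form a basis of $V$ in the standard basis. For $1\le i\le n-1$ let $\phi_i:SL_2(\mathbb F)\to SL_n(\mathbb F)$ embed $\begin{pmatrix}a&b\\c&d\end{pmatrix}$ as the diagonal block in rows and columns $n-i,\,n-i+1$ (so $a$ is the $(i+1)$-th diagonal entry from the bottom), identity elsewhere. Put $x_i(p)=\phi_i\begin{pmatrix}1&p\\0&1\end{pmatrix}$,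 $y_i(p)=\phi_i\begin{pmatrix}1&0\\ p&1\end{pmatrix}$, $\dot s_i=\phi_i\begin{pmatrix}0&-1\\1&0\end{pmatrix}$. Attach to the cell in row $r$, column $c$ of $\lambda$ the index $n-k+r-c$. A reading word on $\lambda$ is a bijective filling of the cells with $1,\dots,m$ ($m=|\lambda|$) decreasing left to right in rows and top to bottom in columns. Fix one, let $b_l$ be the cell with entry $l$ and $i_l$ the index attached to it. For a Go-diagram $D$ let $G_D$ be the set of products $g=g_1g_2\cdots g_m$ with $g_l=x_{i_l}(q_l)\dot s_{i_l}^{-1}$, $q_l\in\mathbb F$, if $D(b_l)=\bullet$; $g_l=y_{i_l}(p_l)$, $p_l\in\mathbb F^*$, if $D(b_l)=+$; $g_l=\dot s_{i_l}$ if $D(b_l)=\circ$. The Deodhar component $\mathcal D_D\subset Gr_{k,n}$ is the set of row spans of the $k\times n$ matrices $A$ with $A_{r,j}=g_{n+1-j,\,r}$, $g\in G_D$ (i.e. the span of the first $k$ columns of $g$, coordinates read from bottom to top). It does not depend on the reading word. *)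

(* Defs.v *)
From mathcomp Require Import all_boot all_order all_algebra.
From mathcomp Require Import reals.
From mathcomp Require Import complex.

Set Implicit Arguments.
Unset Strict Implicit.
Unset Printing Implicit Defensive.

Import GRing.Theory.
Local Open Scope ring_scope.

(* Conventions.  Everything is numbered from 0: rows by 'I_k, columns by
   'I_(n - k), and border edges, pipes and coordinates by 'I_n, so that
   j : 'I_n stands for the label j.+1. *)

(* The k parts of a partition whose diagram fits in a k x (n - k) rectangle. *)
Record box_partition (k n : nat) := BoxPartition {
  parts :> 'I_k -> nat;
  parts_bound : forall r, (parts r <= n - k)%N;
  parts_anti : forall r r' : 'I_k, (r <= r')%N -> (parts r' <= parts r)%N
}.

Definition cell k n (lam : box_partition k n) : predArgType :=
  {b : 'I_k * 'I_(n - k) | (b.2 < lam b.1)%N}.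

Definition cell_row k n (lam : box_partition k n) (b : cell lam) : 'I_k :=
  (val b).1.
Definition cell_col k n (lam : box_partition k n) (b : cell lam) : 'I_(n - k) :=
  (val b).2.

(* Unit edges of the rectangle.  The grid points are (i, j) with i <= k and
   j <= n - k, where (0, 0) is the north-west corner:
     inl (r, c) is the vertical edge from (r, c) to (r + 1, c),
     inr (r, c) is the horizontal edge from (r, c) to (r, c + 1). *)
Definition edge (k n : nat) : predArgType :=
  ('I_k * 'I_(n - k).+1 + 'I_k.+1 * 'I_(n - k))%type.

(* [widen_ord (leqnSn _)] keeps the value, [lift ord0] adds 1. *)
Definition west k n (lam : box_partition k n) (b : cell lam) : edge k n :=
  inl (cell_row b, widen_ord (leqnSn _) (cell_col b)).
Definition east k n (lam : box_partition k n) (b : cell lam) : edge k n :=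
  inl (cell_row b, lift ord0 (cell_col b)).
Definition north k n (lam : box_partition k n) (b : cell lam) : edge k n :=
  inr (widen_ord (leqnSn _) (cell_row b), cell_col b).
Definition south k n (lam : box_partition k n) (b : cell lam) : edge k n :=
  inr (lift ord0 (cell_row b), cell_col b).

Definition west_border_edge k n (r : 'I_k) : edge k n := inl (r, ord0).

Definition nw_border k n (e : edge k n) : bool :=
  match e with
  | inl (_, c) => c == 0%N :> nat
  | inr (r, _) => r == 0%N :> nat
  end.

(* [#|[set i | c < lam i]|] is the length of column c. *)
Definition se_border k n (lam : box_partition k n) (e : edge k n) : bool :=
  match e with
  | inl (r, c) => c == lam r :> nat
  | inr (r, c) => r == #|[set i : 'I_k | (c < lam i)%N]| :> nat
  end.

(* The number of unit steps made, before traversing e, by a lattice path that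
   starts at the north-east corner (0, n - k) and steps south or west. *)
Definition se_position k n (e : edge k n) : nat :=
  match e with
  | inl (r, c) => (r + (n - k - c))%N
  | inr (r, c) => (r + (n - k - c.+1))%N
  end.

Definition se_label k n (lam : box_partition k n) (j : 'I_n) (e : edge k n)
    : bool :=
  se_border lam e && (se_position e == j).

Variant tile := Cross | Elbow.

Definition pipe_dream k n (lam : box_partition k n) : Type := cell lam -> tile.

Section PipeDream.
Variables (k n : nat) (lam : box_partition k n) (D : pipe_dream lam).

(* A pipe entering the cell b through e leaves it through f. *)
Definition tile_conn (b : cell lam) (e f : edge k n) : bool :=
  match D b with
  | Cross => ((e, f) == (east b, west b)) || ((e, f) == (south b, north b))
  | Elbow => ((e, f) == (east b, north b)) || ((e, f) == (south b, west b))
  end.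

Definition pipe_step : rel (edge k n) :=
  fun e f => [exists b, tile_conn b e f].

Definition on_pipe (j : 'I_n) (e : edge k n) : bool :=
  [exists e0, se_label lam j e0 && connect pipe_step e0 e].

Definition pipe_lt (e f : edge k n) : bool :=
  [exists i : 'I_n, exists j : 'I_n,
     [&& on_pipe i e, on_pipe j f & (i < j)%N]].

Variant symbol := Plus | White | Black.

(* The two pipes of a cell are always distinct. *)
Definition symbol_at (b : cell lam) : symbol :=
  match D b with
  | Elbow => Plus
  | Cross => if pipe_lt (east b) (south b) then White else Black
  end.

Definition go_diagram : Prop :=
  forall b, D b = Elbow -> ~~ pipe_lt (south b) (east b).

Definition is_source (s : 'I_n) (e : edge k n) : bool :=
  nw_border e && on_pipe s e.

(* The label of the west boundary edge in row r.  Each border edge lies on a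
   pipe, so that the default value is never used; 'I_n needs some element. *)
Definition west_label (hkn : (k <= n)%N) (r : 'I_k) : 'I_n :=
  odflt (widen_ord hkn r) [pick j | is_source j (west_border_edge n r)].

Definition jump_allowed (b : cell lam) : bool :=
  match symbol_at b with White => false | _ => true end.

(* A restricted path enters b through e and jumps, leaving b through f. *)
Definition jumps (b : cell lam) (e f : edge k n) : bool :=
  [&& e \in [:: north b; west b], f \in [:: east b; south b],
      ~~ tile_conn b f e, jump_allowed b & pipe_lt f e].

(* Restricted paths traverse the pipes backwards, hence [tile_conn b f e]. *)
Definition restricted_step : rel (edge k n) :=
  fun e f => [exists b, tile_conn b f e || jumps b e f].

Section Weights.
Variables (F : fieldType) (beta : cell lam -> F).

(* The path visits the edge e and then the edges of P in turn. *)
Definition path_weight (e : edge k n) (P : seq (edge k n)) : F :=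
  \prod_(ef <- zip (e :: P) P) \prod_(b | jumps b ef.1 ef.2) beta b.

(* Every step increases the sum of the coordinates of the midpoint of the edge
   by 1, so that a path has fewer than n steps and length <= n for P excludes
   nothing. *)
Definition full_path_matrix : 'M[F]_n :=
  \matrix_(s, t)
    \sum_(e : edge k n | is_source s e)
      \sum_(P : n.-bseq (edge k n) |
              path restricted_step e P && se_label lam t (last e P))
        path_weight e P.

Definition path_matrix (hkn : (k <= n)%N) : 'M[F]_(k, n) :=
  \matrix_(r, t) full_path_matrix (west_label hkn r) t.

Definition admissible_jumps : Prop :=
  forall b, match symbol_at b return Prop with
            | Plus => beta b != 0
            | White => beta b = 0
            | Black => True
            end.

End Weights.

Definition restricted_path_matrices (F : fieldType) (hkn : (k <= n)%N)
    (M : 'M[F]_(k, n)) : Prop :=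
  exists beta : cell lam -> F,
    admissible_jumps beta /\ M = path_matrix beta hkn.

End PipeDream.

Section Deodhar.
Variables (F : fieldType) (k n : nat).

Definition mx2 (a b c d : F) : 'M[F]_2 :=
  \matrix_(i, j) nth 0 (nth [::] [:: [:: a; b]; [:: c; d]] i) j.

(* Rows and columns n - i and n - i + 1, numbered from 1, are o and o + 1. *)
Definition phi (i : nat) (M : 'M[F]_2) : 'M[F]_n :=
  let o := (n - i).-1 in
  \matrix_(p, q)
    if (o <= p <= o.+1)%N && (o <= q <= o.+1)%N
    then M (inord (p - o)) (inord (q - o))
    else (p == q)%:R.

Definition x_mx (i : nat) (p : F) : 'M[F]_n := phi i (mx2 1 p 0 1).
Definition y_mx (i : nat) (p : F) : 'M[F]_n := phi i (mx2 1 0 p 1).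
Definition s_mx (i : nat) : 'M[F]_n := phi i (mx2 0 (-1) 1 0).

Variable lam : box_partition k n.

Definition cell_index (b : cell lam) : nat :=
  (n - k + cell_row b - cell_col b)%N.

(* A reading word is given by the inverse of the filling: [w l] is the cell
   whose entry is l.+1. *)
Definition reading_word (w : 'I_#|cell lam| -> cell lam) : Prop :=
  [/\ bijective w,
      forall l l', cell_row (w l) = cell_row (w l') ->
        (cell_col (w l) < cell_col (w l'))%N -> (l' < l)%N
    & forall l l', cell_col (w l) = cell_col (w l') ->
        (cell_row (w l) < cell_row (w l'))%N -> (l' < l)%N].

Variables (D : pipe_dream lam) (w : 'I_#|cell lam| -> cell lam).

Definition deodhar_factor (par : cell lam -> F) (b : cell lam) : 'M[F]_n :=
  let i := cell_index b in
  match symbol_at D b with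
  | Plus => y_mx i (par b)
  | White => s_mx i
  | Black => x_mx i (par b) *m invmx (s_mx i)
  end.

Definition deodhar_products (g : 'M[F]_n) : Prop :=
  exists par : cell lam -> F,
    (forall b, symbol_at D b = Plus -> par b != 0) /\
    g = \big[mulmx/1%:M]_(l < #|cell lam|) deodhar_factor par (w l).

Definition rows (M : 'M[F]_(k, n)) : seq 'rV[F]_n :=
  [seq row r M | r <- enum 'I_k].

Definition grassmannian : Type :=
  {V : {vspace 'rV[F]_n} | \dim V == k}.

Definition realizes (M : 'M[F]_(k, n)) (V : grassmannian) : Prop :=
  basis_of (val V) (rows M).

(* The first k columns of g as rows, read from bottom to top. *)
Definition deodhar_matrix (hkn : (k <= n)%N) (g : 'M[F]_n) : 'M[F]_(k, n) :=
  \matrix_(r, j) g (rev_ord j) (widen_ord hkn r).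

Definition deodhar_component (hkn : (k <= n)%N) (V : grassmannian) : Prop :=
  exists g, deodhar_products g /\ val V = <<rows (deodhar_matrix hkn g)>>%VS.

End Deodhar.

(* Main.v *)
Require Import Defs.
From mathcomp Require Import all_boot all_order all_algebra.
From mathcomp Require Import reals complex.
From mathcomp Require Import zify ring.

Set Implicit Arguments.
Unset Strict Implicit.
Unset Printing Implicit Defensive.

Import GRing.Theory.
Local Open Scope ring_scope.

(** Attach to every grid edge e the row vector [transfer_row D beta e] of total
    weights of the restricted paths from e to the sinks.  Only the rows at the
    west boundary enter the path matrix, but the whole field of vectors obeys a
    local rule.  In a cell with east vector u and south vector v, the north and
    west vectors are
      u and v + beta u   at an elbow,
      v and u            at a white stone,
      v and u + beta v   at a black stone
    ([transfer_row_cell_rule]).  This is where the Go-condition is used: the two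
    pipes of a cell have different labels, and comparing them shows that only a
    path entering from the west can jump, which it can unless the cell is a white
    stone.

    The Deodhar factor of a cell acts in the same way, up to signs, on the rows
    of the transposed and reversed product g.  Reading the cells one by one from
    the south-east, the rows of the partial product are therefore, up to signs
    that depend on the diagram only, the vectors at the border of the part of the
    diagram not yet read ([deodhar_prod_row]), provided that each jump parameter
    is the parameter of the factor up to sign.  At the end this border is the
    north-west border, so that path matrices and Deodhar matrices have the same
    row spans.  The products g are invertible, whence the rows are independent.

    For uniqueness, the span V of the rows of the path matrix determines the
    vectors at all edges.  Let W(x), for a grid point x, be the span of
    the vectors on a lattice path from x to the south-west corner
    ([corner_span]); by the local rule it does not depend on the path, V is W at
    the north-west corner, and around each cell W(NE) is the sum of W(NW) and
    W(SE).  Hence W at the top of the column line of x is V + W(x)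
    ([corner_span_top]).  Going through the cells from the south-east, suppose
    that the vectors at the east and south of a cell are known.  Then so is the
    space W at the top of its west column line, and this space contains the west
    vector.  It contains at most one of the vectors v + beta u (or u + beta v),
    since otherwise it would contain u and v, hence W(NE), and would equal W one
    step further east on the top side; this is impossible because the vectors on
    the north-west border are independent ([transfer_row_nw_eq]). *)

(** * Grid edges and frontiers *)

Section Edges.
Variables (k n : nat) (lam : box_partition k n).
Implicit Types (b : cell lam) (e f : edge k n) (p : seq (cell lam)).

(** The parts as a function on all natural numbers, which makes bounds on rows a
    matter of linear arithmetic. *)
Definition row_len (i : nat) : nat := if insub i is Some r then lam r else 0%N.

Lemma row_lenE (r : 'I_k) : row_len r = lam r.
Proof. by rewrite /row_len valK. Qed.

Lemma row_len_le i : (row_len i <= n - k)%N.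
Proof. by rewrite /row_len; case: insub => // r; apply: parts_bound. Qed.

Lemma row_len_gt0 i : (0 < row_len i)%N -> (i < k)%N.
Proof. by rewrite /row_len; case: insubP. Qed.

Lemma row_len_anti i i' : (i <= i')%N -> (row_len i' <= row_len i)%N.
Proof.
move=> le_ii; rewrite /row_len; case: insubP => // r' _ r'E.
case: insubP => [r _ rE|]; first by apply: parts_anti; rewrite rE r'E.
by move=> nik; move: (ltn_ord r'); rewrite r'E ltnNge (leq_trans _ le_ii) // leqNgt.
Qed.

Definition erow e : nat := match e with inl (r, _) => r | inr (r, _) => r end.
Definition ecol e : nat := match e with inl (_, c) => c | inr (_, c) => c end.
(** Every step along a pipe, from the south-east to the north-west, decreases
    the level by one. *)
Definition level e : nat := (erow e + ecol e)%N.

(** Coordinates are those of the north or west end of an edge, so that an edge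
    and the cell to its south-east have the same coordinates. *)
Definition nw_of b e : bool := (e == north b) || (e == west b).
Definition se_of b e : bool := (e == east b) || (e == south b).

Lemma level_lt e : (k <= n)%N -> (level e < n)%N.
Proof.
rewrite /level; case: e => -[[r hr] [c hc]] /= hkn; lia.
Qed.

Lemma se_position_lt e : (k <= n)%N -> (se_position e < n)%N.
Proof. case: e => -[[r hr] [c hc]] /= hkn; lia. Qed.

Lemma cell_bound b : (cell_col b < row_len (cell_row b))%N.
Proof. by rewrite row_lenE; exact: (valP b). Qed.

Lemma cell_inj b b' : cell_row b = cell_row b' :> nat ->
  cell_col b = cell_col b' :> nat -> b = b'.
Proof.
move=> rE cE; apply: val_inj; rewrite [LHS]surjective_pairing.
by rewrite [RHS]surjective_pairing; congr pair; apply: val_inj.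
Qed.

Lemma cell_exists r c : (c < row_len r)%N ->
  exists b, cell_row b = r :> nat /\ cell_col b = c :> nat.
Proof.
move=> hc; have hr : (r < k)%N by apply: row_len_gt0; case: (row_len r) hc.
have hc' : (c < n - k)%N by apply: leq_trans hc (row_len_le r).
have hb : ((Ordinal hr, Ordinal hc').2 < lam (Ordinal hr, Ordinal hc').1)%N.
  by rewrite -row_lenE.
by exists (exist _ (Ordinal hr, Ordinal hc') hb).
Qed.

Lemma nw_ofE b e :
  nw_of b e = (erow e == cell_row b) && (ecol e == cell_col b).
Proof.
by rewrite /nw_of /north /west; case: e => -[r c] //=; rewrite ?orbF.
Qed.

Lemma se_ofE b e : se_of b e =
  match e with
  | inl (r, c) => (r == cell_row b :> nat) && (c == (cell_col b).+1 :> nat)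
  | inr (r, c) => (r == (cell_row b).+1 :> nat) && (c == cell_col b :> nat)
  end.
Proof.
by rewrite /se_of /east /south; case: e => -[r c] //=; rewrite ?orbF.
Qed.

Lemma nw_of_inj b b' e : nw_of b e -> nw_of b' e -> b = b'.
Proof.
rewrite !nw_ofE => /andP[/eqP rE /eqP cE] /andP[/eqP rE' /eqP cE'].
by apply: cell_inj; rewrite -?rE -?cE.
Qed.

Lemma se_of_inj b b' e : se_of b e -> se_of b' e -> b = b'.
Proof.
rewrite !se_ofE; case: e => -[r c] /andP[/eqP rE /eqP cE] /andP[/eqP rE' /eqP cE'];
  apply: cell_inj; lia.
Qed.

Lemma nw_of_north b : nw_of b (north b). Proof. by rewrite /nw_of eqxx. Qed.
Lemma nw_of_west b : nw_of b (west b). Proof. by rewrite /nw_of eqxx orbT. Qed.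
Lemma se_of_east b : se_of b (east b). Proof. by rewrite /se_of eqxx. Qed.
Lemma se_of_south b : se_of b (south b). Proof. by rewrite /se_of eqxx orbT. Qed.

Lemma level_nw b e : nw_of b e -> level e = (cell_row b + cell_col b)%N.
Proof. by rewrite nw_ofE /level => /andP[/eqP-> /eqP->]. Qed.

Lemma level_se b e : se_of b e -> level e = (cell_row b + cell_col b).+1.
Proof.
by rewrite se_ofE /level; case: e => -[r c] /= /andP[/eqP-> /eqP->]; rewrite ?addnS.
Qed.

Lemma nw_of_exists e : reflect (exists b, nw_of b e) (ecol e < row_len (erow e))%N.
Proof.
apply: (iffP idP) => [/cell_exists[b [rE cE]]|[b]].
  by exists b; rewrite nw_ofE rE cE !eqxx.
by rewrite nw_ofE => /andP[/eqP-> /eqP->]; apply: cell_bound.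
Qed.

Lemma nw_border_not_se b e : nw_border e -> ~~ se_of b e.
Proof.
by rewrite se_ofE; case: e => -[r c] /= /eqP->; rewrite ?andbF.
Qed.

(** The edges of the south-east border of what is left of the diagram when the
    cells of p have been removed from it. *)
Definition frontier p e : bool :=
  [forall b, nw_of b e ==> (b \in p)] &&
  (nw_border e || [exists b, se_of b e && (b \notin p)]).

Definition nw_le b b' : bool :=
  (cell_row b <= cell_row b')%N && (cell_col b <= cell_col b')%N.

Definition se_closed p : Prop :=
  forall b b', nw_le b b' -> b \in p -> b' \in p.

(** Edges at the same position lie on one diagonal.  If e' were further
    south-east than e, the cell at the south-east of e would be weakly north-west
    of the cell at the north-west of e'; but the former is removed and the latter
    is not. *)
Lemma frontier_level_le p e e' : se_closed p -> frontier p e -> frontier p e' ->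
  se_position e = se_position e' -> (level e' <= level e)%N.
Proof.
move=> pP /andP[/forallP eP _] /andP[_ e'P] posE.
rewrite leqNgt; apply/negP => lt_ee'.
case/orP: e'P => [nwe'|/existsP[b' /andP[seb' b'p]]].
  move: e e' nwe' posE lt_ee' {eP} => [[[r hr] [c hc]]|[[r hr] [c hc]]]
    [[[r' hr'] [c' hc']]|[[r' hr'] [c' hc']]]; rewrite /level /= => /eqP; lia.
have leb : (erow e <= cell_row b')%N && (ecol e <= cell_col b')%N.
  have := ltn_ord (cell_col b'); move: seb' posE lt_ee'; rewrite se_ofE /level.
  case: e e' {eP} => -[[r hr] [c hc]] [] [[r' hr'] [c' hc']] /=; lia.
have /andP[le_r le_c] := leb.
have /nw_of_exists[b be] : (ecol e < row_len (erow e))%N.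
  by apply: leq_ltn_trans le_c (leq_trans (cell_bound b') (row_len_anti le_r)).
case/negP: b'p; apply: pP (implyP (eP b) be).
by move: be leb; rewrite nw_ofE /nw_le => /andP[/eqP-> /eqP->].
Qed.

Lemma frontier_inj p e e' : se_closed p -> frontier p e -> frontier p e' ->
  se_position e = se_position e' -> e = e'.
Proof.
move=> pP eP e'P posE.
have := frontier_level_le pP eP e'P posE; have := frontier_level_le pP e'P eP (esym posE).
move: posE {eP e'P}; rewrite /level.
case: e e' => -[[r hr] [c hc]] [] [[r' hr'] [c' hc']] /= posE le1 le2; try lia.
  by have [? ?] : r = r' /\ c = c' by [lia]; subst; congr inl; congr pair; apply: val_inj.
by have [? ?] : r = r' /\ c = c' by [lia]; subst; congr inr; congr pair; apply: val_inj.
Qed.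

(** The rows that meet column c are an initial segment, of length the number of
    its elements. *)
Lemma col_height (i c : nat) :
  (i <= k)%N -> (c < row_len i)%N = (i < #|[set r : 'I_k | (c < lam r)%N]|)%N.
Proof.
move=> le_ik; set S := [set r | _].
have cardI : #|[set r : 'I_k | (r < i)%N]| = i.
  rewrite cardE -(size_map val) /= -[RHS](size_iota 0).
  apply/perm_size/uniq_perm; rewrite ?iota_uniq ?(map_inj_uniq val_inj) ?enum_uniq //.
  move=> j; rewrite mem_iota /=; apply/mapP/idP => [[r]|hj].
    by rewrite mem_enum inE => ? ->.
  by exists (Ordinal (leq_trans hj le_ik)) => //; rewrite mem_enum inE.
have [hc|hc] := ltnP c (row_len i); symmetry.
  have ik : (i < k)%N by apply: row_len_gt0; case: (row_len i) hc.
  rewrite -[X in (X < _)%N]cardI; apply/proper_card/properP; split.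
    apply/subsetP => r; rewrite !inE => /ltnW ri; apply: leq_trans hc _.
    by rewrite -row_lenE; apply: row_len_anti.
  by exists (Ordinal ik); rewrite !inE ?ltnn // -row_lenE.
apply/negbTE; rewrite -leqNgt -[leqRHS]cardI; apply/subset_leq_card/subsetP => r.
rewrite !inE => cr; rewrite ltnNge; apply/negP => /row_len_anti.
by rewrite row_lenE => /(leq_trans cr); rewrite ltnNge hc.
Qed.

Lemma se_border_frontier e : se_border lam e = frontier [::] e.
Proof.
have nwE : [forall b, nw_of b e ==> (b \in [::])] = ~~ (ecol e < row_len (erow e))%N.
  apply/forallP/idP => [h|/nw_of_exists h b].
    by apply/nw_of_exists => -[b be]; have := h b; rewrite be.
  by apply/implyP => be; case: h; exists b.
have seE : [exists b, se_of b e && (b \notin [::])] =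
    match e with
    | inl (r, c) => (0 < c)%N && (c <= row_len r)%N
    | inr (r, c) => (0 < r)%N && (c < row_len r.-1)%N
    end.
  apply/existsP/idP => [[b /andP[+ _]]|].
    rewrite se_ofE; case: e {nwE} => -[r c] /= /andP[/eqP-> /eqP->];
    exact: cell_bound.
  case: e {nwE} => -[[r hr] [c hc]] /= /andP[].
    case: c hc => //= c hc _ /cell_exists[b [rE cE]].
    by exists b; rewrite se_ofE rE cE !eqxx.
  case: r hr => //= r hr _ /cell_exists[b [rE cE]].
  by exists b; rewrite se_ofE rE cE !eqxx.
rewrite /frontier nwE seE; case: e {nwE seE} => -[r c] /=.
  by rewrite row_lenE; lia.
have rk : (r <= k)%N by rewrite -ltnS.
rewrite (col_height _ rk) (col_height _ (leq_trans (leq_pred r) rk)).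
by move: #|_| => h; case: (r : nat) => [|r'] /=; lia.
Qed.

Lemma se_border_not_nw b e : se_border lam e -> ~~ nw_of b e.
Proof.
by rewrite se_border_frontier => /andP[/forallP/(_ b)]; rewrite implybF.
Qed.

Lemma se_border_inj e e' : se_border lam e -> se_border lam e' ->
  se_position e = se_position e' -> e = e'.
Proof. by rewrite !se_border_frontier; apply: frontier_inj => b b'. Qed.

Lemma se_of_border b e : se_of b e -> se_border lam e \/ exists b', nw_of b' e.
Proof.
move=> be; have [/nw_of_exists ?|ne] := boolP (ecol e < row_len (erow e))%N; first by right.
left; rewrite se_border_frontier; apply/andP; split; last first.
  by apply/orP; right; apply/existsP; exists b; rewrite be.
apply/forallP => b'; apply/implyP => b'e; case/negP: ne.
by apply/nw_of_exists; exists b'.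
Qed.

Lemma nw_border_cases e : nw_border e -> se_border lam e \/ exists b', nw_of b' e.
Proof.
move=> be; have [/nw_of_exists ?|ne] := boolP (ecol e < row_len (erow e))%N; first by right.
left; rewrite se_border_frontier /frontier be andbT.
apply/forallP => b'; apply/implyP => b'e; case/negP: ne.
by apply/nw_of_exists; exists b'.
Qed.

End Edges.

(** * Pipes *)

Section Pipes.
Variables (k n : nat) (lam : box_partition k n) (D : pipe_dream lam).
Implicit Types (b : cell lam) (e f : edge k n) (i j : 'I_n).

Lemma tile_conn_se b e f : tile_conn D b e f -> se_of b e.
Proof.
rewrite /tile_conn /se_of.
by case: (D b) => /orP[] /eqP[-> _]; rewrite eqxx ?orbT.
Qed.

Lemma tile_conn_nw b e f : tile_conn D b e f -> nw_of b f.
Proof.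
rewrite /tile_conn /nw_of.
by case: (D b) => /orP[] /eqP[_ ->]; rewrite eqxx ?orbT.
Qed.

Lemma tile_conn_fun b e f f' :
  tile_conn D b e f -> tile_conn D b e f' -> f = f'.
Proof.
rewrite /tile_conn.
by case: (D b) => /orP[] /eqP[-> ->] /orP[] /eqP[].
Qed.

Lemma tile_conn_inj b e e' f :
  tile_conn D b e f -> tile_conn D b e' f -> e = e'.
Proof.
rewrite /tile_conn.
by case: (D b) => /orP[] /eqP[-> ->] /orP[] /eqP[].
Qed.

Lemma tile_conn_exists b f : nw_of b f -> exists e, tile_conn D b e f.
Proof.
rewrite /tile_conn /nw_of.
by case: (D b) => /orP[] /eqP->; [exists (south b)|exists (east b)
  |exists (east b)|exists (south b)]; rewrite eqxx ?orbT.
Qed.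

Lemma pipe_step_fun e f f' : pipe_step D e f -> pipe_step D e f' -> f = f'.
Proof.
move=> /existsP[b bef] /existsP[b' bef'].
have bb := se_of_inj (tile_conn_se bef) (tile_conn_se bef').
by apply: tile_conn_fun bef _; rewrite bb.
Qed.

Lemma pipe_step_inj e e' f : pipe_step D e f -> pipe_step D e' f -> e = e'.
Proof.
move=> /existsP[b bef] /existsP[b' bef'].
have bb := nw_of_inj (tile_conn_nw bef) (tile_conn_nw bef').
by apply: tile_conn_inj bef _; rewrite bb.
Qed.

Lemma pipe_step_level e f : pipe_step D e f -> level e = (level f).+1.
Proof.
by case/existsP => b h; rewrite (level_se (tile_conn_se h)) (level_nw (tile_conn_nw h)).
Qed.

Lemma connect_level e f : connect (pipe_step D) e f -> (level f <= level e)%N.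
Proof.
case/connectP => q + ->; elim: q e => //= g q IH e /andP[eg /IH].
by rewrite (pipe_step_level eg) => /leqW.
Qed.

Lemma connect_level_eq e f :
  connect (pipe_step D) e f -> level e = level f -> e = f.
Proof.
case/connectP => -[_ -> //|g q /= /andP[eg gq] ->] lev.
have /connect_level : connect (pipe_step D) g (last g q) by apply/connectP; exists q.
by rewrite -lev (pipe_step_level eg) ltnn.
Qed.

Lemma connect_total e f f' : connect (pipe_step D) e f ->
  connect (pipe_step D) e f' ->
  connect (pipe_step D) f f' \/ connect (pipe_step D) f' f.
Proof.
case/connectP => q qP ->; elim: q e qP => [e _|g q IH e /= /andP[eg gq]]; first by left.
case/connectP=> -[_ ->|g' q' /= /andP[eg' gq'] f'E].
  by right; apply: connect_trans (connect1 eg) _; apply/connectP; exists q.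
apply: IH => //; rewrite (pipe_step_fun eg eg').
by apply/connectP; exists q'.
Qed.

Lemma on_pipe_border j e : se_border lam e -> on_pipe D j e = (se_position e == j).
Proof.
move=> be; apply/existsP/eqP => [[e0 /andP[/andP[be0 /eqP <-] /connectP]]|posE].
  case=> q; elim/last_ind: q => [_ ->//|q f _].
  rewrite rcons_path last_rcons => /andP[_ /existsP[b ebf]] ef.
  by case/negP: (se_border_not_nw b be); rewrite ef (tile_conn_nw ebf).
by exists e; rewrite /se_label be posE eqxx connect0.
Qed.

(** Pipes can be followed backwards in only one way, so a step neither leaves a
    pipe nor merges two of them. *)
Lemma on_pipe_step j e f : pipe_step D e f -> on_pipe D j f = on_pipe D j e.
Proof.
move=> ef; apply: eq_existsb => e0; case: (boolP (se_label _ _ _)) => //= /andP[be0 _].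
apply/connectP/idP => [[q]|e0e]; last first.
  by apply/connectP/(connect_trans e0e)/connect1.
elim/last_ind: q => [_ /= fE|q g _].
  case/existsP: ef => b /tile_conn_nw bf.
  by case/negP: (se_border_not_nw b be0); rewrite -fE.
rewrite rcons_path last_rcons => /andP[qP lg] fE; rewrite -fE in lg.
by rewrite (pipe_step_inj ef lg); apply/connectP; exists q.
Qed.

Lemma on_pipe_connect j e f :
  connect (pipe_step D) e f -> on_pipe D j f = on_pipe D j e.
Proof.
case/connectP => q + ->; elim: q e => //= g q IH e /andP[eg /IH ->].
exact: on_pipe_step.
Qed.

Lemma on_pipe_uniq i j e : on_pipe D i e -> on_pipe D j e -> i = j.
Proof.
case/existsP => e0 /andP[/andP[b0 /eqP p0] /on_pipe_connect ->].
by rewrite on_pipe_border // p0 => /eqP/val_inj.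
Qed.

Lemma same_pipe j e f : on_pipe D j e -> on_pipe D j f ->
  connect (pipe_step D) e f \/ connect (pipe_step D) f e.
Proof.
case/existsP => e0 /andP[/andP[b0 /eqP p0] c0].
case/existsP => f0 /andP[/andP[bf /eqP pf] cf].
have ef0 : f0 = e0 by apply: (se_border_inj bf b0); rewrite p0 pf.
by apply: connect_total c0 _; rewrite -ef0.
Qed.

(** A pipe stops when it reaches the north-west border. *)
Lemma same_pipe_nw_border j e f : nw_border e -> nw_border f ->
  on_pipe D j e -> on_pipe D j f -> e = f.
Proof.
move=> be bf je jf.
have stop g h : nw_border g -> connect (pipe_step D) g h -> g = h.
  move=> bg /connectP[[_ ->|g' q /= /andP[/existsP[b /tile_conn_se gg'] _]]] //.
  by case/negP: (nw_border_not_se b bg).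
by case: (same_pipe je jf) => /stop ->.
Qed.

(** The levels decrease strictly along a pipe.  The east and south edges of a
    cell have the same level, so this separates the two pipes of a cell. *)
Lemma same_pipe_level j e f : level e = level f ->
  on_pipe D j e -> on_pipe D j f -> e = f.
Proof.
move=> lev je jf.
by case: (same_pipe je jf) => /connect_level_eq ->.
Qed.

Hypothesis hkn : (k <= n)%N.

Lemma on_pipe_exists e : se_border lam e \/ (exists b, nw_of b e) ->
  exists j, on_pipe D j e.
Proof.
have [m] := ubnP (n - level e)%N; elim: m e => // m IH e lt_m [be|[b be]].
  by exists (Ordinal (se_position_lt e hkn)); rewrite on_pipe_border.
have [f bfe] := tile_conn_exists be.
have fe : pipe_step D f e by apply/existsP; exists b.
have [|j jf] := IH f _ (se_of_border (tile_conn_se bfe)).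
  by rewrite (pipe_step_level fe); have := level_lt e hkn; lia.
by exists j; rewrite (on_pipe_step _ fe).
Qed.

Lemma pipe_lt_stepr e f g : pipe_step D f g -> pipe_lt D e g = pipe_lt D e f.
Proof.
move=> fg; apply: eq_existsb => i; apply: eq_existsb => j.
by rewrite (on_pipe_step j fg).
Qed.

Lemma pipe_ltNge e f : (forall j, on_pipe D j e -> ~~ on_pipe D j f) ->
  (exists i, on_pipe D i e) -> (exists j, on_pipe D j f) ->
  pipe_lt D e f = ~~ pipe_lt D f e.
Proof.
move=> neq [i ie] [j jf].
have ltE e' f' i' j' : on_pipe D i' e' -> on_pipe D j' f' ->
    pipe_lt D e' f' = (i' < j')%N.
  move=> ie' jf'; apply/existsP/idP => [[i1 /existsP[j1 /and3P[]]]|lt_ij].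
    by move=> /(on_pipe_uniq ie') <- /(on_pipe_uniq jf') <-.
  by exists i'; apply/existsP; exists j'; rewrite ie' jf'.
rewrite (ltE _ _ _ _ ie jf) (ltE _ _ _ _ jf ie) -leqNgt ltn_neqAle.
case: eqP => // /val_inj ij; case/negP: (neq i ie); by rewrite ij.
Qed.

Lemma pipe_lt_cell b :
  pipe_lt D (east b) (south b) = ~~ pipe_lt D (south b) (east b).
Proof.
apply: pipe_ltNge => [j je||]; last 2 first.
- exact: on_pipe_exists (se_of_border (se_of_east b)).
- exact: on_pipe_exists (se_of_border (se_of_south b)).
apply/negP => /(same_pipe_level _ je) -/(_ _)/eqP//.
by rewrite (level_se (se_of_east b)) (level_se (se_of_south b)) => /(_ erefl).
Qed.

Lemma tile_conn_cross b : D b = Cross ->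
  [/\ tile_conn D b (east b) (west b), tile_conn D b (south b) (north b),
      ~~ tile_conn D b (south b) (west b) & ~~ tile_conn D b (east b) (north b)].
Proof. by rewrite /tile_conn => ->; rewrite !xpair_eqE !eqxx ?orbT. Qed.

Lemma tile_conn_elbow b : D b = Elbow ->
  [/\ tile_conn D b (east b) (north b), tile_conn D b (south b) (west b),
      ~~ tile_conn D b (south b) (north b) & ~~ tile_conn D b (east b) (west b)].
Proof. by rewrite /tile_conn => ->; rewrite !xpair_eqE !eqxx ?orbT. Qed.

Lemma tile_conn_step b e f : tile_conn D b e f -> pipe_step D e f.
Proof. by move=> h; apply/existsP; exists b. Qed.

Lemma jumpsE b e f : nw_of b e -> se_of b f ->
  jumps D b e f = [&& ~~ tile_conn D b f e, jump_allowed D b & pipe_lt D f e].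
Proof.
by move=> be bf; rewrite /jumps !inE -/(nw_of b e) -/(se_of b f) be bf.
Qed.

End Pipes.

(** * Path sums *)

Lemma sum_bseq_cons (T : finType) (V : nmodType) N (G : seq T -> V) :
  \sum_(P : N.+1.-bseq T) G P =
  G [::] + \sum_(x : T) \sum_(P : N.-bseq T) G (x :: P).
Proof.
pose h (u : unit + T * N.-bseq T) : N.+1.-bseq T :=
  match u with inl _ => [bseq] | inr (x, P) => [bseq of x :: P] end.
pose g (P : N.+1.-bseq T) : unit + T * N.-bseq T :=
  match val P with [::] => inl tt | x :: _ => inr (x, behead_bseq P) end.
have hK : cancel h g.
  by case=> [[]|[x P]] //; rewrite /h /g /=; congr (inr (_, _)); apply: val_inj.
have gK : cancel g h.
  by case=> -[|x q] // hq; apply: val_inj.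
rewrite (reindex h); last by exists g => ? _.
rewrite big_sumType /=; congr (_ + _); first by rewrite big_const card_unit /= addr0.
by rewrite pair_bigA; apply: eq_bigr => -[x P].
Qed.

Section Transfer.
Variables (k n : nat) (lam : box_partition k n) (D : pipe_dream lam).
Variables (F : fieldType) (beta : cell lam -> F).
Hypothesis hkn : (k <= n)%N.
Implicit Types (b : cell lam) (e f : edge k n) (t : 'I_n).

Definition step_weight e f : F := \prod_(b | jumps D b e f) beta b.

Definition path_sum N e t : F :=
  \sum_(P : N.-bseq (edge k n) |
          path (restricted_step D) e P && se_label lam t (last e P))
    path_weight D beta e P.

Lemma path_weight_cons e f P :
  path_weight D beta e (f :: P) = step_weight e f * path_weight D beta f P.
Proof. by rewrite /path_weight /= big_cons. Qed.

Lemma path_sum_rec N e t : path_sum N.+1 e t =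
  (se_label lam t e)%:R +
  \sum_(f | restricted_step D e f) step_weight e f * path_sum N f t.
Proof.
rewrite {1}/path_sum big_mkcond /=.
rewrite (@sum_bseq_cons _ _ _ (fun P : seq (edge k n) =>
  if path (restricted_step D) e P && se_label lam t (last e P)
  then path_weight D beta e P else 0)) /=.
congr (_ + _).
  by rewrite /path_weight /= big_nil; case: se_label.
rewrite [RHS]big_mkcond; apply: eq_bigr => f _.
case: (restricted_step D e f) => /=; last by rewrite big1.
rewrite /path_sum big_distrr [RHS]big_mkcond; apply: eq_bigr => P _.
by rewrite path_weight_cons.
Qed.

Lemma restricted_step_cell b e f : nw_of b e ->
  restricted_step D e f = tile_conn D b f e || jumps D b e f.
Proof.
move=> be; apply/existsP/idP => [[b' h]|]; last by exists b.
have b'e : nw_of b' e.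
  case/orP: h => [/tile_conn_nw //|/and3P[+ _ _]]; by rewrite !inE.
by rewrite (nw_of_inj be b'e).
Qed.

Lemma restricted_step_nw_se e f :
  restricted_step D e f -> exists b, nw_of b e /\ se_of b f.
Proof.
case/existsP => b /orP[h|/and3P[+ + _]].
  by exists b; rewrite (tile_conn_nw h) (tile_conn_se h).
by rewrite !inE => ? ?; exists b.
Qed.

(** Levels increase along restricted paths and are less than n, so a longer
    length bound adds no path. *)
Lemma path_sum_stable N e t :
  (n <= (N + level e).+1)%N -> path_sum N.+1 e t = path_sum N e t.
Proof.
elim: N e => [|N IH] e hN.
  rewrite path_sum_rec big1 => [|f ef]; last first.
    case: (restricted_step_nw_se ef) => b [/level_nw be /level_se bf].
    by have := level_lt f hkn; lia.
  rewrite addr0 /path_sum big_mkcond (big_pred1 [bseq]) /=; last first.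
    by move=> P; rewrite [P]bseq0 /= eqxx.
  by rewrite /path_weight big_nil; case: se_label.
rewrite [LHS]path_sum_rec [RHS]path_sum_rec; congr (_ + _).
apply: eq_bigr => f ef; congr (_ * _).
case: (restricted_step_nw_se ef) => b [/level_nw be /level_se bf].
by apply: IH; lia.
Qed.

(** If e carries the source labelled s, this is row s of [full_path_matrix]; the
    vectors at the other edges make a recursion over cells possible. *)
Definition transfer_row e : 'rV[F]_n := \row_t path_sum n e t.

Lemma transfer_row_rec e : transfer_row e =
  \row_t (se_label lam t e)%:R +
  \sum_(f | restricted_step D e f) step_weight e f *: transfer_row f.
Proof.
apply/rowP => t; rewrite !mxE summxE -path_sum_stable ?path_sum_rec; last by lia.
by congr (_ + _); apply: eq_bigr => f _; rewrite !mxE.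
Qed.

(** No restricted step leaves an edge that has no cell to its south-east. *)
Lemma transfer_row_no_cell e : ~~ (ecol e < row_len lam (erow e))%N ->
  transfer_row e = \row_t (se_label lam t e)%:R.
Proof.
move=> ne; rewrite transfer_row_rec big1 ?addr0 // => f ef.
case: (restricted_step_nw_se ef) => b [be _].
by case/negP: ne; apply/nw_of_exists; exists b.
Qed.

Lemma transfer_row_border e :
  se_border lam e -> transfer_row e = \row_t (se_position e == t)%:R.
Proof.
move=> be; rewrite transfer_row_no_cell.
  by apply/rowP => t; rewrite !mxE /se_label be.
by apply/nw_of_exists => -[b]; apply/negP/se_border_not_nw.
Qed.

Lemma transfer_row_nw_sum b e : nw_of b e ->
  transfer_row e =
    \sum_(f <- [:: east b; south b])
      (if tile_conn D b f e then 1 else if jumps D b e f then beta b else 0)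
        *: transfer_row f.
Proof.
move=> be; rewrite transfer_row_rec.
have -> : \row_t (se_label lam t e)%:R = 0 :> 'rV[F]_n.
  apply/rowP => t; rewrite !mxE /se_label.
  by case: (boolP (se_border lam e)) => // /(se_border_not_nw b); rewrite be.
rewrite add0r big_mkcond /=.
have uq : uniq [:: east b; south b] by [].
rewrite (big_uniq _ uq) [RHS]big_mkcond /=; apply: eq_bigr => f _.
rewrite inE inE -/(se_of b f) (restricted_step_cell _ be).
have jE b' : jumps D b' e f -> b' = b.
  by case/and3P; rewrite !inE => /nw_of_inj/(_ be).
case: (boolP (tile_conn D b f e)) => [h|nh] /=.
  rewrite (tile_conn_se h) /step_weight big_pred0 // => b'.
  apply/negP => j; move: (j); rewrite (jE _ j) => /and3P[_ _ /andP[]].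
  by rewrite h.
case: (boolP (jumps D b e f)) => [h|nh']; last by rewrite scale0r if_same.
have -> : se_of b f by case/and3P: (h) => _; rewrite !inE.
rewrite /step_weight (big_pred1 b) // => b'.
by apply/idP/eqP => [/jE //|->].
Qed.

Hypothesis hD : go_diagram D.

(** Of the two jumps in a cell, the one from the north needs the pipe from the
    north to be the larger one: the Go-condition at an elbow and the choice of
    the stone at a crossing exclude it.  The jump from the west is allowed except
    at a white stone. *)
Lemma transfer_row_cell_rule b :
  match symbol_at D b with
  | Plus => transfer_row (north b) = transfer_row (east b) /\
            transfer_row (west b) = transfer_row (south b) + beta b *: transfer_row (east b)
  | White => transfer_row (north b) = transfer_row (south b) /\
             transfer_row (west b) = transfer_row (east b)
  | Black => transfer_row (north b) = transfer_row (south b) /\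
             transfer_row (west b) = transfer_row (east b) + beta b *: transfer_row (south b)
  end.
Proof.
have [Ln Lw] := (transfer_row_nw_sum (nw_of_north b), transfer_row_nw_sum (nw_of_west b)).
have [bn bw] := (nw_of_north b, nw_of_west b).
have [be bs] := (se_of_east b, se_of_south b).
rewrite !big_cons !big_nil !addr0 !jumpsE // in Ln Lw.
case sD: (D b).
  have [Tew Tsn /negbTE Nsw /negbTE Nen] := tile_conn_cross sD.
  rewrite Tsn Nen /= (pipe_lt_stepr _ (tile_conn_step Tsn)) in Ln.
  rewrite Tew Nsw /= (pipe_lt_stepr _ (tile_conn_step Tew)) in Lw.
  move: Ln Lw; rewrite /jump_allowed /symbol_at sD.
  have := pipe_lt_cell D hkn b; case: pipe_lt => /= /esym; [move=> _|move/negbFE->].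
    by rewrite !scale1r !scale0r add0r addr0.
  by rewrite !scale1r !scale0r add0r.
have [Ten Tsw /negbTE Nsn /negbTE New] := tile_conn_elbow sD.
rewrite Ten Nsn /= (pipe_lt_stepr _ (tile_conn_step Ten)) in Ln.
rewrite Tsw New /= (pipe_lt_stepr _ (tile_conn_step Tsw)) in Lw.
move: Ln Lw; rewrite /jump_allowed /symbol_at sD.
rewrite pipe_lt_cell // (negbTE (hD sD)) /=.
by rewrite !scale1r !scale0r addr0 addrC.
Qed.

(** A pipe has a single end on the north-west border, so the sum over the
    sources with a given label has one term. *)
Lemma path_matrix_row r : row r (path_matrix D beta hkn) = transfer_row (west_border_edge n r).
Proof.
set e := west_border_edge n r.
have be : nw_border e by [].
have [j je] := on_pipe_exists D hkn (nw_border_cases lam be).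
have src i : is_source D i e = (i == j).
  rewrite /is_source be; apply/idP/eqP => [ie|->//]; exact: on_pipe_uniq ie je.
have -> : row r (path_matrix D beta hkn) = row j (full_path_matrix D beta).
  apply/rowP => t; rewrite !mxE /west_label; case: pickP => /= [i|/(_ j)].
    by rewrite -/e src => /eqP ->.
  by rewrite -/e src eqxx.
apply/rowP => t; rewrite !mxE (big_pred1 e) // => f.
apply/andP/eqP => [[bf jf]|->]; last by [].
exact: same_pipe_nw_border bf be jf je.
Qed.

End Transfer.

(** * Subspaces at grid points *)

Lemma add_line_shear (F : fieldType) (vT : vectType F) (u v : vT) (a : F) :
  (<[u]> + <[v + a *: u]> = <[u]> + <[v]>)%VS.
Proof.
apply: subv_anti; rewrite !subv_add !addvSl -!memvE /=; apply/andP; split.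
  by rewrite addrC memv_add ?memvZ ?memv_line.
by rewrite -[X in X \in _](addKr (a *: u)) [a *: u + v]addrC memv_add ?memvN ?memvZ ?memv_line.
Qed.

Section Spans.
Variables (k n : nat) (lam : box_partition k n) (D : pipe_dream lam).
Variables (F : fieldType) (beta : cell lam -> F).
Implicit Types (b : cell lam) (e f : edge k n) (t : 'I_n).
Local Notation rho := (transfer_row D beta).

(** The lattice path from the grid point (i, j) to the south-west corner that goes
    west to the boundary and then south. *)
Definition corner_edge i j e : bool :=
  match e with
  | inl (r, c) => (c == 0%N :> nat) && (i <= r)%N
  | inr (r, c) => (r == i :> nat) && (c < j)%N
  end.

Definition corner_span i j : {vspace 'rV[F]_n} :=
  (\sum_(e | corner_edge i j e) <[rho e]>)%VS.

Lemma corner_span_step (P Q : pred (edge k n)) (e : edge k n) :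
  P e -> (forall f, (P f && (f != e)) = Q f) ->
  (\sum_(f | P f) <[rho f]> = <[rho e]> + \sum_(f | Q f) <[rho f]>)%VS.
Proof.
by move=> Pe PQ; rewrite (bigD1 e) //=; congr (_ + _)%VS; apply: eq_bigl.
Qed.

Lemma corner_spanS (i : 'I_k.+1) (j : 'I_(n - k)) :
  corner_span i j.+1 = (<[rho (inr (i, j))]> + corner_span i j)%VS.
Proof.
apply: corner_span_step => [|[[r c]|[r c]]] /=; rewrite ?eqxx ?ltnSn ?andbT //.
by rewrite (inj_eq inr_inj) xpair_eqE -!(inj_eq val_inj) /=; lia.
Qed.

Lemma corner_span_ne b : corner_span (cell_row b) (cell_col b).+1 =
  (<[rho (north b)]> + corner_span (cell_row b) (cell_col b))%VS.
Proof. exact: (corner_spanS (widen_ord (leqnSn _) (cell_row b))). Qed.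

Lemma corner_span_se b : corner_span (cell_row b).+1 (cell_col b).+1 =
  (<[rho (south b)]> + corner_span (cell_row b).+1 (cell_col b))%VS.
Proof. exact: (corner_spanS (lift ord0 (cell_row b))). Qed.

Hypotheses (hkn : (k <= n)%N) (hD : go_diagram D).

(** This is what makes the span along a lattice path depend on its end only. *)
Lemma cell_lines b : (<[rho (north b)]> + <[rho (west b)]> =
  <[rho (east b)]> + <[rho (south b)]>)%VS.
Proof.
have := transfer_row_cell_rule beta hkn hD b.
by case: symbol_at => -[-> ->]; rewrite ?add_line_shear // addvC.
Qed.

(** Induction on the column: the lattice path that starts with the given vertical
    edge is pushed across the cells to its west, by [cell_lines]. *)
Lemma corner_span_vertical j (r : 'I_k) (c : 'I_(n - k).+1) : c = j :> nat ->
  (j <= row_len lam r)%N ->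
  corner_span r j = (<[rho (inl (r, c))]> + corner_span r.+1 j)%VS.
Proof.
elim: j c => [|j IH] c cj le_c.
  have -> : c = ord0 by apply: val_inj.
  apply: corner_span_step => [|[[r' c']|[r' c']]] /=; rewrite ?leqnn ?ltn0 ?andbF //.
  by rewrite (inj_eq inl_inj) xpair_eqE -!(inj_eq val_inj) /=; lia.
have [b [/val_inj br bc]] := cell_exists le_c.
have eW : corner_span r j = (<[rho (west b)]> + corner_span r.+1 j)%VS.
  by rewrite /west br (IH (widen_ord (leqnSn _) (cell_col b)) bc (ltnW le_c)).
have -> : inl (r, c) = east b.
  by congr (inl (_, _)); [rewrite -br | apply: val_inj; rewrite /= cj -bc].
rewrite -bc -br corner_span_ne corner_span_se br bc eW.
by rewrite !addvA cell_lines.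
Qed.

Lemma corner_span_west b : corner_span (cell_row b) (cell_col b) =
  (<[rho (west b)]> + corner_span (cell_row b).+1 (cell_col b))%VS.
Proof. by apply: corner_span_vertical; rewrite // ltnW // cell_bound. Qed.

Lemma corner_span_east b : corner_span (cell_row b) (cell_col b).+1 =
  (<[rho (east b)]> + corner_span (cell_row b).+1 (cell_col b).+1)%VS.
Proof. by apply: corner_span_vertical; rewrite // cell_bound. Qed.

Lemma corner_span_up i j : (i <= k)%N -> (forall r, (r < i)%N -> (j <= row_len lam r)%N) ->
  (corner_span i j <= corner_span 0 j)%VS.
Proof.
elim: i => // i IH ik le_j; apply: subv_trans (IH _ _); last 2 first.
- exact: ltnW.
- by move=> r ri; apply: le_j; rewrite ltnW.
have hj : (j < (n - k).+1)%N by rewrite ltnS (leq_trans (le_j i _) (row_len_le _ _)).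
rewrite (@corner_span_vertical j (Ordinal ik) (Ordinal hj)) ?le_j //=.
exact: addvSr.
Qed.

Hypothesis beta_neq0 : forall b, symbol_at D b = Plus -> beta b != 0.

(** The east vector is a combination of the west and south vectors because the
    parameter at an elbow is nonzero. *)
Lemma corner_span_cell b : (corner_span (cell_row b) (cell_col b).+1 <=
  corner_span (cell_row b) (cell_col b) +
  corner_span (cell_row b).+1 (cell_col b).+1)%VS.
Proof.
rewrite {1}corner_span_east subv_add addvSr andbT corner_span_west corner_span_se.
have sub : (<[rho (west b)]> + <[rho (south b)]> <= <[rho (west b)]> +
  corner_span (cell_row b).+1 (cell_col b) +
  (<[rho (south b)]> + corner_span (cell_row b).+1 (cell_col b)))%VS.
  by rewrite addvS ?addvSl.
apply: subv_trans sub; have := transfer_row_cell_rule beta hkn hD b.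
case sD: (symbol_at D b) => -[_ ->].
- have b0 := beta_neq0 sD.
  have eE : rho (east b) = (beta b)^-1 *:
      ((rho (south b) + beta b *: rho (east b)) - rho (south b)).
    by rewrite addrC addKr scalerK.
  by rewrite -memvE [X in X \in _]eE memvZ // memv_add ?memvN ?memv_line.
- exact: addvSl.
- by rewrite addvC add_line_shear addvSr.
Qed.

(** The cells between the column lines j and j + 1, taken upwards from row i: each
    one lets the generator at its north-east be replaced by the space at its
    south-east. *)
Lemma corner_span_top_step i j : (i <= k)%N ->
  (forall r, (r < i)%N -> (j < row_len lam r)%N) ->
  (corner_span 0 j.+1 <= corner_span 0 j + corner_span i j.+1)%VS.
Proof.
elim: i => [|i IH] ik lt_j; first exact: addvSr.
apply: subv_trans (IH _ _) _; [exact: ltnW | by move=> r ri; apply: lt_j; rewrite ltnW |].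
rewrite subv_add addvSl /=.
have [b [br bc]] := cell_exists (lt_j i (ltnSn i)).
rewrite -br -bc; apply: subv_trans (corner_span_cell b) _.
rewrite br bc; apply: addvS (subvv _); apply: corner_span_up; first exact: ltnW.
by move=> r ri; apply/ltnW/lt_j/ltnW.
Qed.

Lemma corner_span_top i j : (i <= k)%N ->
  (forall r, (r < i)%N -> (j <= row_len lam r)%N) -> (j <= n - k)%N ->
  corner_span 0 j = (corner_span 0 0 + corner_span i j)%VS.
Proof.
move=> ik le_j jnk; apply: subv_anti; apply/andP; split; last first.
  rewrite subv_add (corner_span_up ik le_j) andbT.
  elim: (j) jnk => // j' IH lt_j; apply: subv_trans (IH (ltnW lt_j)) _.
  by rewrite (@corner_spanS ord0 (Ordinal lt_j)) addvSr.
elim: j le_j jnk => [|j IH] le_j jnk; first exact: addvSl.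
apply: subv_trans (corner_span_top_step ik le_j) _.
rewrite subv_add addvSr andbT; apply: subv_trans (IH _ (ltnW jnk)) _.
  by move=> r /le_j/ltnW.
apply: addvS (subvv _) _.
have := @corner_spanS (inord i) (Ordinal jnk); rewrite inordK ?ltnS // => ->.
exact: addvSr.
Qed.

(** If the space at the top of the west column line of b contained the east and
    south vectors of b, it would contain the space at the north-east corner of b,
    and by [corner_span_top_step] the next space on the top side. *)
Lemma east_south_not_top_span b :
  ~~ (corner_span 0 (cell_col b).+1 <= corner_span 0 (cell_col b))%VS ->
  ~~ (<[rho (east b)]> + <[rho (south b)]> <= corner_span 0 (cell_col b))%VS.
Proof.
apply: contra => sub.
have le_c r : (r <= cell_row b)%N -> (cell_col b < row_len lam r)%N.
  by move=> /(row_len_anti lam); apply: leq_trans; rewrite cell_bound.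
apply: subv_trans (corner_span_top_step (ltnW (ltn_ord (cell_row b))) _) _.
  by move=> r /ltnW/le_c.
rewrite subv_add subvv corner_span_east corner_span_se addvA subv_add sub.
by apply: corner_span_up => // r; rewrite ltnS => /le_c/ltnW.
Qed.

End Spans.

(** * The elementary matrices *)

(** Here o0 and o1 are the two indices of the block, numbered from 0. *)
Section Phi.
Variables (F : fieldType) (n i : nat) (o0 o1 : 'I_n).
Hypotheses (o0E : o0 = (n - i).-1 :> nat) (o1E : o1 = o0.+1 :> nat).
Implicit Types (a b c d : F).

Lemma phi_mx2E a b c d p q : phi n i (mx2 a b c d) p q =
  if p == o0 then (if q == o0 then a else if q == o1 then b else 0)
  else if p == o1 then (if q == o0 then c else if q == o1 then d else 0)
  else (p == q)%:R.
Proof.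
have bandE (r : 'I_n) : ((n - i).-1 <= r <= (n - i).-1.+1)%N = (r == o0) || (r == o1).
  by rewrite -!(inj_eq val_inj) /= o1E o0E; lia.
have o10 : (o1 == o0) = false by rewrite -(inj_eq val_inj) /= o1E; lia.
have v0 : inord (o0 - (n - i).-1) = 0 :> 'I_2.
  by apply: val_inj; rewrite -o0E subnn /= inordK.
have v1 : inord (o1 - (n - i).-1) = 1 :> 'I_2.
  by apply: val_inj; rewrite -o0E o1E subSnn /= inordK.
rewrite mxE !bandE; case: (eqVneq p o0) => [->|p0] /=.
  rewrite v0; case: (eqVneq q o0) => [->|q0] /=; first by rewrite v0 mxE.
  by case: (eqVneq q o1) => [->|q1] /=; rewrite ?v1 ?mxE // eq_sym (negbTE q0).
case: (eqVneq p o1) => [->|p1] //=.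
rewrite v1; case: (eqVneq q o0) => [->|q0] /=; first by rewrite v0 mxE.
by case: (eqVneq q o1) => [->|q1] /=; rewrite ?v1 ?mxE // eq_sym (negbTE q1).
Qed.

Lemma mulmx_phi_mx2 m (B : 'M[F]_(m, n)) a b c d r q :
  (B *m phi n i (mx2 a b c d)) r q =
  if q == o0 then B r o0 * a + B r o1 * c
  else if q == o1 then B r o0 * b + B r o1 * d else B r q.
Proof.
have o10 : (o1 == o0) = false by rewrite -(inj_eq val_inj) /= o1E; lia.
rewrite mxE (bigD1 o0) //= (bigD1 o1) ?o10 //= addrA.
under [X in _ + X]eq_bigr => l /andP[l0 l1] do
  rewrite phi_mx2E (negbTE l0) (negbTE l1).
rewrite !phi_mx2E !eqxx o10.
case: (eqVneq q o0) => [->|q0].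
  by rewrite big1 ?addr0 // => l /andP[/negbTE-> _]; rewrite mulr0.
case: (eqVneq q o1) => [->|q1].
  by rewrite big1 ?addr0 // => l /andP[_ /negbTE->]; rewrite mulr0.
rewrite !mulr0 !add0r (bigD1 q) ?q0 //= eqxx mulr1 big1 ?addr0 // => l /andP[_ /negbTE->].
by rewrite mulr0.
Qed.

Lemma phi_mx2M a b c d a' b' c' d' :
  phi n i (mx2 a b c d) *m phi n i (mx2 a' b' c' d') =
  phi n i (mx2 (a * a' + b * c') (a * b' + b * d')
               (c * a' + d * c') (c * b' + d * d')).
Proof.
have o10 : (o1 == o0) = false by rewrite -(inj_eq val_inj) /= o1E; lia.
apply/matrixP => r q; rewrite mulmx_phi_mx2 !phi_mx2E !eqxx o10.
have [r0|r0] := eqVneq r o0; have [q0|q0] := eqVneq q o0; first by [].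
- by have [q1|q1] := eqVneq q o1.
- have [r1|r1] := eqVneq r o1; first by [].
  by rewrite q0 (negbTE r0) !mul0r addr0.
have [r1|r1] := eqVneq r o1; first by have [q1|q1] := eqVneq q o1.
by have [->|q1] := eqVneq q o1; rewrite // (negbTE r1) !mul0r addr0.
Qed.

Lemma phi_mx2_1 : phi n i (mx2 1 0 0 1) = 1%:M :> 'M[F]_n.
Proof.
have o10 : (o1 == o0) = false by rewrite -(inj_eq val_inj) /= o1E; lia.
apply/matrixP => r q; rewrite phi_mx2E mxE.
have [->|r0] := eqVneq r o0.
  by have [q0|q0] := eqVneq q o0; rewrite ?if_same.
have [->|//] := eqVneq r o1; have [->|q0] := eqVneq q o0; first by rewrite o10.
by have [q1|q1] := eqVneq q o1.
Qed.

Lemma phi_mx2_inv a b c d a' b' c' d' :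
  a * a' + b * c' = 1 -> a * b' + b * d' = 0 ->
  c * a' + d * c' = 0 -> c * b' + d * d' = 1 ->
  phi n i (mx2 a b c d) \in unitmx /\
  invmx (phi n i (mx2 a b c d)) = phi n i (mx2 a' b' c' d').
Proof.
move=> e1 e2 e3 e4.
have M1 : phi n i (mx2 a b c d) *m phi n i (mx2 a' b' c' d') = 1%:M.
  by rewrite phi_mx2M e1 e2 e3 e4 phi_mx2_1.
have [U _] := mulmx1_unit M1; split=> //.
by rewrite -[LHS]mulmx1 -M1 mulmxA mulVmx // mul1mx.
Qed.

Lemma s_mx_inv : s_mx F n i \in unitmx /\ invmx (s_mx F n i) = phi n i (mx2 0 1 (-1) 0).
Proof. by apply: phi_mx2_inv; ring. Qed.

Lemma x_mx_unit p : x_mx n i p \in @unitmx F n.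
Proof. by have [] := @phi_mx2_inv 1 p 0 1 1 (- p) 0 1; try ring. Qed.

Lemma y_mx_unit p : y_mx n i p \in @unitmx F n.
Proof. by have [] := @phi_mx2_inv 1 0 p 1 1 0 (- p) 1; try ring. Qed.

Lemma x_mx_s_inv p : x_mx n i p *m invmx (s_mx F n i) = phi n i (mx2 (- p) 1 (-1) 0).
Proof.
have [_ ->] := s_mx_inv; rewrite /x_mx phi_mx2M.
by congr (phi n i (mx2 _ _ _ _)); ring.
Qed.
End Phi.

(** * Rows of Deodhar products *)

Lemma se_position_west k n (lam : box_partition k n) (b : cell lam) :
  se_position (west b) = se_position (south b).
Proof. by rewrite /= /bump; have := ltn_ord (cell_col b); lia. Qed.

Lemma se_position_south k n (lam : box_partition k n) (b : cell lam) :
  se_position (south b) = (se_position (east b)).+1.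
Proof. by []. Qed.

Section Product.
Variables (k n : nat) (hkn : (k <= n)%N) (lam : box_partition k n).
Variables (D : pipe_dream lam) (hD : go_diagram D) (F : fieldType).
Implicit Types (b : cell lam) (e f : edge k n) (p w : seq (cell lam)).
Implicit Types (beta par : cell lam -> F).

Definition pos e : 'I_n := Ordinal (se_position_lt e hkn).

Lemma rev_pos_south b :
  rev_ord (pos (south b)) = (n - cell_index b).-1 :> nat.
Proof.
rewrite /= /bump /cell_index /=.
by have := ltn_ord (cell_col b); have := ltn_ord (cell_row b); lia.
Qed.

Lemma rev_pos_east b :
  rev_ord (pos (east b)) = (rev_ord (pos (south b))).+1 :> nat.
Proof.
rewrite /= /bump /=.
by have := ltn_ord (cell_col b); have := ltn_ord (cell_row b); lia.
Qed.

(** Columns are read backwards, as in the definition of the Deodhar matrix: q is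
    a position on a frontier. *)
Lemma mul_deodhar_factor m (B : 'M[F]_(m, n)) par b r q :
  (B *m deodhar_factor D par b) r (rev_ord q) =
  let Be := B r (rev_ord (pos (east b))) in
  let Bs := B r (rev_ord (pos (south b))) in
  if q == pos (east b) then
    match symbol_at D b with Plus => Be | White => - Bs | Black => Bs end
  else if q == pos (south b) then
    match symbol_at D b with
    | Plus => Bs + par b * Be
    | White => Be
    | Black => - Be - par b * Bs
    end
  else B r (rev_ord q).
Proof.
have := (@mulmx_phi_mx2 F n (cell_index b) _ _ (rev_pos_south b) (rev_pos_east b) m B).
have := (@x_mx_s_inv F n (cell_index b) _ _ (rev_pos_south b) (rev_pos_east b)).
rewrite /deodhar_factor /y_mx /s_mx => xs mul; rewrite /=.
have es : (pos (east b) == pos (south b)) = false.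
  by rewrite -(inj_eq val_inj) /= /bump /=; lia.
case: (symbol_at D b); rewrite ?xs mul !(inj_eq rev_ord_inj);
  (case: (eqVneq q (pos (east b))) => [->|_]; rewrite ?es);
  case: (eqVneq q (pos (south b))) => [_|_] //; ring.
Qed.

Lemma deodhar_factor_unit par b : deodhar_factor D par b \in unitmx.
Proof.
have [sU _] := (@s_mx_inv F n (cell_index b) _ _ (rev_pos_south b) (rev_pos_east b)).
rewrite /deodhar_factor; case: (symbol_at D b) => //.
  exact: (@y_mx_unit F n (cell_index b) _ _ (rev_pos_south b) (rev_pos_east b)).
rewrite unitmx_mul unitmx_inv sU andbT.
exact: (@x_mx_unit F n (cell_index b) _ _ (rev_pos_south b) (rev_pos_east b)).
Qed.

Definition deodhar_prod par p : 'M[F]_n :=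
  \big[mulmx/1%:M]_(b <- p) deodhar_factor D par b.

Lemma deodhar_prod_unit par p : deodhar_prod par p \in unitmx.
Proof.
rewrite /deodhar_prod; elim/big_rec: _ => [|b B _ BU]; first exact: unitmx1.
by rewrite unitmx_mul deodhar_factor_unit.
Qed.

Lemma deodhar_prod_rcons par p b :
  deodhar_prod par (rcons p b) = deodhar_prod par p *m deodhar_factor D par b.
Proof.
rewrite /deodhar_prod; elim: p => [|a p IH] /=.
  by rewrite big_cons !big_nil mul1mx mulmx1.
by rewrite !big_cons IH mulmxA.
Qed.

(** How reading the cell b changes the signs that relate the rows of the product
    to the transfer rows; E q is the sign at position q. *)
Definition update_signs b (E : nat -> F) (q : nat) : F :=
  if q == se_position (east b) then
    match symbol_at D b with Plus => E q | White => - E q.+1 | Black => E q.+1 end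
  else if q == se_position (south b) then
    match symbol_at D b with Plus => E q | White => E q.-1 | Black => - E q.-1 end
  else E q.

Definition row_sign p : nat -> F := foldl (fun E b => update_signs b E) (fun=> 1) p.

Lemma row_sign_rcons p b : row_sign (rcons p b) = update_signs b (row_sign p).
Proof. by rewrite /row_sign foldl_rcons. Qed.

Lemma row_sign_sqr p q : row_sign p q * row_sign p q = 1.
Proof.
elim/last_ind: p q => [|p b IH] q; first by rewrite mulr1.
rewrite row_sign_rcons /update_signs.
by case: symbol_at; do 2?case: ifP => _; rewrite ?mulrNN IH.
Qed.

(** The jump parameter at b is the factor parameter times this sign, the product
    of the signs at the east and south of b when b is read. *)
Definition cell_sign w b : F :=
  let p := take (index b w) w in
  row_sign p (se_position (east b)) * row_sign p (se_position (south b)).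

Lemma cell_sign_sqr w b : cell_sign w b * cell_sign w b = 1.
Proof. by rewrite /cell_sign mulrACA !row_sign_sqr mulr1. Qed.

Lemma frontier_rcons_cases p b e : uniq (rcons p b) -> frontier (rcons p b) e ->
  nw_of b e \/ [/\ frontier p e, e != east b & e != south b].
Proof.
rewrite rcons_uniq => /andP[bp _] /andP[/forallP inP outP].
have [be|nbe] := boolP (nw_of b e); [by left | right].
have [outE ne] : (nw_border e || [exists b', se_of b' e && (b' \notin p)]) /\ ~~ se_of b e.
  case/orP: outP => [nwe|/existsP[b' /andP[b'e]]].
    by rewrite nwe; split=> //; apply: nw_border_not_se.
  rewrite mem_rcons inE negb_or => /andP[b'b b'p]; split.
    by apply/orP; right; apply/existsP; exists b'; rewrite b'e.
  by apply: contra b'b => /se_of_inj/(_ b'e) ->.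
split; last 2 first.
- by apply: contra ne => /eqP->; apply: se_of_east.
- by apply: contra ne => /eqP->; apply: se_of_south.
rewrite /frontier outE andbT; apply/forallP => b'; apply/implyP => b'e.
have := implyP (inP b') b'e; rewrite mem_rcons inE => /orP[/eqP b'b|//].
by case/negP: nbe; rewrite -b'b.
Qed.

Lemma frontier_se_of p b e : b \notin p -> se_closed (rcons p b) -> se_of b e -> frontier p e.
Proof.
move=> bp pbP be; apply/andP; split; last first.
  by apply/orP; right; apply/existsP; exists b; rewrite be.
apply/forallP => b'; apply/implyP => b'e.
have : b' \in rcons p b.
  apply: (pbP b); last by rewrite mem_rcons mem_head.
  move: be b'e; rewrite se_ofE nw_ofE /nw_le.
  by case: e => -[r c] /= /andP[/eqP rE /eqP cE] /andP[]; lia.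
rewrite mem_rcons inE => /orP[/eqP bb|//].
by have := level_se be; rewrite -bb (level_nw b'e); lia.
Qed.

(** Reading a cell replaces its east and south edges on the frontier by its north
    and west edges.  Edges of a frontier are determined by their positions, so
    the factor of the cell leaves the rows of all other edges unchanged; on the
    two rows that it changes, it acts by the rule of the transfer rows, up to
    signs. *)
Lemma deodhar_prod_row w par beta : uniq w -> (forall i, se_closed (take i w)) ->
  (forall b, beta b = cell_sign w b * par b) ->
  forall i, (i <= size w)%N -> forall e, frontier (take i w) e -> forall j,
  deodhar_prod par (take i w) (rev_ord j) (rev_ord (pos e)) =
    row_sign (take i w) (se_position e) * transfer_row D beta e 0 j.
Proof.
move=> w_uniq w_closed betaE; elim=> [|i IH] le_i e e_front j.
  rewrite take0 -se_border_frontier in e_front.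
  rewrite take0 /deodhar_prod big_nil (transfer_row_border D beta hkn e_front) !mxE mul1r.
  by rewrite (inj_eq rev_ord_inj) eq_sym.
have [b Eb] : exists b, w = take i w ++ b :: drop i.+1 w.
  case wE: w le_i => [|b0 w'] // le_i; exists (nth b0 w i).
  by rewrite -wE -drop_nth ?cat_take_drop // wE.
set p := take i w in Eb; have sz_p : size p = i by rewrite size_takel // ltnW.
have tE : take i.+1 w = rcons p b.
  by rewrite Eb -cat_rcons take_size_cat // size_rcons sz_p.
have pb_uniq : uniq (rcons p b) by rewrite -tE take_uniq.
have bp : b \notin p by move: pb_uniq; rewrite rcons_uniq => /andP[].
have bw : index b w = i.
  by rewrite Eb index_cat (negbTE bp) /= eqxx addn0.
have east_front := frontier_se_of bp (_ : se_closed (rcons p b)) (se_of_east b).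
have south_front := frontier_se_of bp (_ : se_closed (rcons p b)) (se_of_south b).
rewrite -tE in east_front south_front.
have rho_e := IH (ltnW le_i) _ (east_front (w_closed _)).
have rho_s := IH (ltnW le_i) _ (south_front (w_closed _)).
rewrite tE in e_front *; rewrite deodhar_prod_rcons.
rewrite mul_deodhar_factor /= rho_e rho_s row_sign_rcons /update_signs.
have posE f : (pos e == pos f) = (se_position e == se_position f) by [].
rewrite !posE.
have sg q := row_sign_sqr p q.
have beta_b : par b = beta b *
    (row_sign p (se_position (east b)) * row_sign p (se_position (south b))).
  by rewrite betaE mulrAC /cell_sign bw -/p mulrACA !sg !mul1r.
have := transfer_row_cell_rule beta hkn hD b.
case: (frontier_rcons_cases pb_uniq e_front) => [be|[e_front' neE neS]]; last first.
  move=> _.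
  have neq f : frontier p f -> e != f -> (se_position e == se_position f) = false.
    by move=> fc; apply: contraNF => /eqP/(frontier_inj (w_closed i) e_front' fc)->.
  rewrite (neq _ (east_front (w_closed _)) neE) (neq _ (south_front (w_closed _)) neS).
  exact: IH (ltnW le_i) _ e_front' j.
case/orP: be => /eqP->.
  rewrite eqxx; case: (symbol_at D b) => -[-> _] //.
  by rewrite mulNr.
rewrite se_position_west eqxx se_position_south (gtn_eqF (ltnSn _)) /= -se_position_south.
have Se := sg (se_position (east b)); have Ss := sg (se_position (south b)).
move: beta_b Se Ss; move: (row_sign p (se_position (east b)))
  (row_sign p (se_position (south b))) => Ee Es beta_b Se Ss.
case: (symbol_at D b) => -[_ ->] //; rewrite !mxE beta_b mulrDr.
  congr (_ + _); transitivity (Ee * Ee * (Es * (beta b * path_sum D beta n (east b) j))).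
    by ring.
  by rewrite Se mul1r.
rewrite !mulNr; congr (_ - _).
transitivity (Es * Es * (Ee * (beta b * path_sum D beta n (south b) j))); first by ring.
by rewrite Ss mul1r.
Qed.

End Product.

(** * Reading words *)

Section Word.
Variables (k n : nat) (lam : box_partition k n).
Variables (w : 'I_#|cell lam| -> cell lam) (hw : reading_word w).

Definition word : seq (cell lam) := [seq w l | l <- enum 'I_#|cell lam|].

Lemma word_inj : injective w. Proof. by case: hw => /bij_inj. Qed.

Lemma word_uniq : uniq word.
Proof. by rewrite map_inj_uniq ?enum_uniq //; apply: word_inj. Qed.

Lemma mem_word b : b \in word.
Proof.
case: hw => -[v _ vK] _ _; rewrite -(vK b).
by apply: map_f; rewrite mem_enum.
Qed.

Lemma mem_take_word i l : (w l \in take i word) = (l < i)%N.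
Proof.
by rewrite in_take ?mem_word // index_map ?index_enum_ord //; apply: word_inj.
Qed.

(** Go along the row and then along the column: the corner cell between the two
    belongs to the diagram because the rows get weakly shorter downwards. *)
Lemma word_anti l l' : nw_le (w l) (w l') -> (l' <= l)%N.
Proof.
case: hw => -[v vK wK] row_lt col_lt /andP[le_r le_c].
have [b [br bc]] : exists b : cell lam,
    cell_row b = cell_row (w l) /\ cell_col b = cell_col (w l').
  have [|b [br bc]] := @cell_exists _ _ lam (cell_row (w l)) (cell_col (w l')).
    by apply: leq_trans (row_len_anti lam le_r); apply: cell_bound.
  by exists b; split; apply: val_inj.
rewrite -(wK b) in br bc; move: (v b) br bc => m br bc.
apply: (@leq_trans m).
  have [lt_r|ge_r] := ltnP (cell_row (w l)) (cell_row (w l')).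
    by apply/ltnW/col_lt; rewrite ?br.
  suff /word_inj -> : w m = w l' by [].
  by apply: cell_inj; rewrite ?bc // br; apply/eqP; rewrite eqn_leq le_r.
have [lt_c|ge_c] := ltnP (cell_col (w l)) (cell_col (w l')).
  by apply/ltnW/row_lt; rewrite ?bc.
suff /word_inj -> : w m = w l by [].
by apply: cell_inj; rewrite ?br // bc; apply/eqP; rewrite eqn_leq le_c ge_c.
Qed.

Lemma word_se_closed i : se_closed (take i word).
Proof.
case: (hw) => -[v vK wK] _ _ b b'.
rewrite -(wK b) -(wK b') !mem_take_word => /word_anti.
exact: leq_ltn_trans.
Qed.

Lemma word_frontier e : nw_border e -> frontier word e.
Proof.
move=> be; rewrite /frontier be andbT; apply/forallP => b.
by rewrite mem_word implybT.
Qed.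

End Word.

(** * Deodhar matrices and path matrices *)

Lemma mem_rows (F : fieldType) k n (M : 'M[F]_(k, n)) r : row r M \in rows M.
Proof. by apply: map_f; rewrite mem_enum. Qed.

Lemma free_rows (F : fieldType) k n (M : 'M[F]_(k, n)) N :
  M *m N = 1%:M -> free (rows M).
Proof.
move=> MN; have -> : rows M = [tuple row i M | i < k] :> seq _.
  by rewrite /rows /=; congr map.
apply/freeP => u u0 i.
have uM : (\row_j u j) *m M = 0.
  rewrite -[RHS]u0 mulmx_sum_row; apply: eq_bigr => j _.
  by rewrite mxE -tnth_nth tnth_mktuple.
have : (\row_j u j) *m M *m N = 0 by rewrite uM mul0mx.
by rewrite -mulmxA MN mulmx1 => /rowP/(_ i); rewrite !mxE.
Qed.

Section DeodharRows.
Variables (k n : nat) (hkn : (k <= n)%N) (lam : box_partition k n).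
Variables (D : pipe_dream lam) (hD : go_diagram D) (F : fieldType).
Variables (w : 'I_#|cell lam| -> cell lam) (hw : reading_word w).
Implicit Types (b : cell lam) (e f : edge k n) (beta par : cell lam -> F).

Lemma deodhar_products_word par :
  \big[mulmx/1%:M]_(l < #|cell lam|) deodhar_factor D par (w l) =
  deodhar_prod D par (word w).
Proof. by rewrite /deodhar_prod /word big_map enumT [index_enum _]unlock. Qed.

(** The change of variables between factor parameters and jump parameters; it is
    an involution since it only changes signs. *)
Definition regauge par b : F := cell_sign D F (word w) b * par b.

Lemma regaugeK par b : regauge (regauge par) b = par b.
Proof. by rewrite /regauge mulrA cell_sign_sqr mul1r. Qed.

Lemma regauge_neq0 par b : (regauge par b != 0) = (par b != 0).
Proof.
have := cell_sign_sqr D F (word w) b; rewrite /regauge mulf_eq0.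
by case: eqP => //= ->; rewrite mul0r => /esym/eqP; rewrite oner_eq0.
Qed.

Section Jumps.
Variable beta : cell lam -> F.
Let g := deodhar_prod D (regauge beta) (word w).

Lemma deodhar_row e j : nw_border e ->
  g (rev_ord j) (rev_ord (pos hkn e)) =
  row_sign D F (word w) (se_position e) * transfer_row D beta e 0 j.
Proof.
move=> be; have := deodhar_prod_row hkn hD (word_uniq hw) (word_se_closed hw)
  (fun b => esym (regaugeK beta b)).
move=> /(_ (size (word w)) (leqnn _) e); rewrite take_size.
exact: (fun h => h (word_frontier hw be) j).
Qed.

(** The west boundary occupies the last k positions, and the Deodhar matrix lists
    them from bottom to top. *)
Lemma row_deodhar_matrix r :
  row (rev_ord r) (deodhar_matrix hkn g) =
  row_sign D F (word w) (se_position (west_border_edge n r)) *: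
    row r (path_matrix D beta hkn).
Proof.
rewrite path_matrix_row; apply/rowP => j; rewrite 3!mxE.
have -> : widen_ord hkn (rev_ord r) = rev_ord (pos hkn (west_border_edge n r)).
  by apply: val_inj => /=; have := ltn_ord r; lia.
by rewrite deodhar_row // !mxE.
Qed.

Lemma span_rows_deodhar : <<rows (deodhar_matrix hkn g)>>%VS =
  <<rows (path_matrix D beta hkn)>>%VS.
Proof.
have sg q := row_sign_sqr D F (word w) q.
apply: subv_anti; apply/andP; split; apply/span_subvP => u /mapP[r _ ->].
  by rewrite -[r]rev_ordK row_deodhar_matrix memvZ // memv_span // mem_rows.
rewrite -[row r _]scale1r -(sg (se_position (west_border_edge n r))) -scalerA.
by rewrite -row_deodhar_matrix memvZ // memv_span // mem_rows.
Qed.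

Lemma free_rows_deodhar : free (rows (deodhar_matrix hkn g)).
Proof.
pose N : 'M[F]_(n, k) := \matrix_(j, r) invmx g (widen_ord hkn r) (rev_ord j).
apply: (@free_rows _ _ _ _ N); apply/matrixP => r s; rewrite !mxE.
have /matrixP/(_ (widen_ord hkn s) (widen_ord hkn r)) :=
  mulVmx (deodhar_prod_unit hkn D (regauge beta) (word w)).
rewrite !mxE -/g (reindex_inj rev_ord_inj) -(inj_eq val_inj) /= eq_sym => <-.
by apply: eq_bigr => j _; rewrite !mxE mulrC.
Qed.

Lemma path_matrix_basis :
  basis_of <<rows (path_matrix D beta hkn)>> (rows (path_matrix D beta hkn)).
Proof.
rewrite basisEdim subvv -span_rows_deodhar.
by rewrite (eqP free_rows_deodhar) !size_map leqnn.
Qed.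

Lemma dim_span_rows : \dim <<rows (path_matrix D beta hkn)>> = k.
Proof.
by rewrite -span_rows_deodhar (eqP free_rows_deodhar) size_map -cardE card_ord.
Qed.

(** A row of the inverse of g gives a linear form that vanishes on all vectors
    of the north-west border but the one at the chosen edge. *)
Lemma corner_span_strict j : (j < n - k)%N ->
  ~~ (corner_span D beta 0 j.+1 <= corner_span D beta 0 j)%VS.
Proof.
move=> jnk; pose e0 : edge k n := inr (ord0, Ordinal jnk).
pose u : 'cV[F]_n := \col_t invmx g (rev_ord (pos hkn e0)) (rev_ord t).
pose K : 'Hom('rV[F]_n, 'M[F]_1) := linfun (mulmxr u).
have KE e : nw_border e -> K (transfer_row D beta e) =
    (row_sign D F (word w) (se_position e) * (e0 == e)%:R)%:M.
  move=> be; rewrite lfunE /=; apply/matrixP => a c; rewrite !ord1 !mxE mulr1n.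
  have -> : (e0 == e) = (rev_ord (pos hkn e0) == rev_ord (pos hkn e)).
    rewrite (inj_eq rev_ord_inj) -(inj_eq val_inj) /=.
    apply/eqP/eqP => [<-//|pE].
    apply: (@frontier_inj _ _ lam (word w)) => //; rewrite ?word_frontier //.
    by rewrite -(take_size (word w)); apply: word_se_closed.
  have /matrixP/(_ (rev_ord (pos hkn e0)) (rev_ord (pos hkn e))) :=
    mulVmx (deodhar_prod_unit hkn D (regauge beta) (word w)).
  rewrite !mxE => <-; rewrite mulr_sumr [RHS](reindex_inj rev_ord_inj) /=.
  apply: eq_bigr => t _; rewrite -/g deodhar_row // !mxE.
  by rewrite mulrCA [X in _ = _ * X]mulrA row_sign_sqr mul1r mulrC.
apply/negP => sub.
have /subvP kerK : (corner_span D beta 0 j <= lker K)%VS.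
  apply/subv_sumP => e ej; rewrite -memvE memv_ker KE; last first.
    by case: e ej => -[r c] /= /andP[/eqP->].
  have -> : (e0 == e) = false.
    by apply/eqP => ee; move: ej; rewrite -ee /= ltnn.
  by rewrite mulr0 raddf0.
have e0K : K (transfer_row D beta e0) = 0.
  apply/eqP; rewrite -memv_ker; apply/kerK/(subvP sub).
  by rewrite (corner_spanS D beta ord0 (Ordinal jnk)) (subvP (addvSl _ _)) ?memv_line.
have /matrixP/(_ 0 0) := etrans (esym e0K) (KE e0 isT).
rewrite !mxE eqxx mulr1 mulr1n => /esym/eqP.
have := row_sign_sqr D F (word w) (se_position e0).
by move=> + /eqP s0; rewrite s0 mul0r => /esym/eqP; rewrite oner_eq0.
Qed.

End Jumps.
End DeodharRows.

(** * Uniqueness *)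

Lemma shear_coef_uniq (F : fieldType) (vT : vectType F) (X : {vspace vT})
    (u v : vT) (a a' : F) : ~~ (<[u]> + <[v]> <= X)%VS ->
  v + a *: u \in X -> v + a' *: u \in X -> a = a'.
Proof.
move=> nX va va'; apply/eqP; apply: contraR nX => neq.
have uX : u \in X.
  have: (a - a') *: u \in X.
    have -> : (a - a') *: u = (v + a *: u) - (v + a' *: u).
      by rewrite opprD addrACA subrr add0r scalerBl.
    exact: memvB.
  by rewrite rpredZeq subr_eq0 (negbTE neq).
rewrite subv_add -!memvE uX -(addrK (a *: u) v) memvB // memvZ //.
Qed.

Section Uniqueness.
Variables (k n : nat) (hkn : (k <= n)%N) (lam : box_partition k n).
Variables (D : pipe_dream lam) (hD : go_diagram D) (F : fieldType).
Implicit Types (b : cell lam) (e f : edge k n).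
Variables (beta beta' : cell lam -> F).
Hypotheses (beta_neq0 : forall b, symbol_at D b = Plus -> beta b != 0)
           (beta'_neq0 : forall b, symbol_at D b = Plus -> beta' b != 0).

Lemma corner_span_rows (gam : cell lam -> F) :
  corner_span D gam 0 0 = <<rows (path_matrix D gam hkn)>>%VS.
Proof.
apply: subv_anti; apply/andP; split.
  apply/subv_sumP => -[[r c]|[r c]] /andP[]; rewrite ?ltn0 // => /eqP c0 _.
  rewrite -memvE (_ : c = ord0); last exact: val_inj.
  by rewrite -(path_matrix_row D gam hkn) memv_span // mem_rows.
apply/span_subvP => u /mapP[r _ ->]; rewrite path_matrix_row.
by rewrite memvE (sumv_sup (west_border_edge n r)).
Qed.

(** Both west vectors lie in the space at the top of the west column line, which
    is the same for both families of parameters and cannot contain two different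
    points of the line on which the west vectors vary. *)
Lemma transfer_row_nw_eq b :
  transfer_row D beta (east b) = transfer_row D beta' (east b) ->
  transfer_row D beta (south b) = transfer_row D beta' (south b) ->
  corner_span D beta (cell_row b).+1 (cell_col b) =
    corner_span D beta' (cell_row b).+1 (cell_col b) ->
  corner_span D beta 0 0 = corner_span D beta' 0 0 ->
  ~~ (corner_span D beta 0 (cell_col b).+1 <= corner_span D beta 0 (cell_col b))%VS ->
  forall e, nw_of b e -> transfer_row D beta e = transfer_row D beta' e.
Proof.
move=> eqE eqS eqC eq0 strict.
have le_c r : (r <= cell_row b)%N -> (cell_col b <= row_len lam r)%N.
  by move=> /(row_len_anti lam) /(leq_trans (cell_bound b))/ltnW.
have top (gam : cell lam -> F) : (forall b, symbol_at D b = Plus -> gam b != 0) ->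
    corner_span D gam 0 (cell_col b) = (corner_span D gam 0 0 +
      corner_span D gam (cell_row b).+1 (cell_col b))%VS.
  by move=> gam0; apply: corner_span_top => //; apply: ltnW; apply: ltn_ord.
have topE : corner_span D beta 0 (cell_col b) = corner_span D beta' 0 (cell_col b).
  by rewrite !top // eqC eq0.
have west_top (gam : cell lam -> F) :
    transfer_row D gam (west b) \in corner_span D gam 0 (cell_col b).
  rewrite memvE; apply: subv_trans (corner_span_up _ hkn hD (ltnW (ltn_ord (cell_row b))) _).
    by rewrite (corner_span_west gam hkn hD) addvSl.
  by move=> r /ltnW/le_c.
have := east_south_not_top_span hkn hD beta_neq0 strict.
have := west_top beta'; have := west_top beta; rewrite -topE.
have := transfer_row_cell_rule beta' hkn hD b; have := transfer_row_cell_rule beta hkn hD b.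
case: (symbol_at D b) => -[nE wE] [nE' wE'] w_in w'_in nsub e /orP[] /eqP ->;
  rewrite ?nE ?nE' ?wE ?wE' ?eqE ?eqS //; congr (_ + _ *: _).
  by apply: (shear_coef_uniq nsub); rewrite ?eqE ?eqS -?wE -?wE' // -eqE -eqS -wE.
rewrite addvC in nsub.
by apply: (shear_coef_uniq nsub); rewrite ?eqE ?eqS -?wE -?wE' // -eqE -eqS -wE.
Qed.

Hypothesis strict : forall j, (j < n - k)%N ->
  ~~ (corner_span D beta 0 j.+1 <= corner_span D beta 0 j)%VS.
Hypothesis span_eq :
  <<rows (path_matrix D beta hkn)>>%VS = <<rows (path_matrix D beta' hkn)>>%VS.

(** Rows of cells are treated from bottom to top, so that the spaces on the south
    side of a row are known, and each row from right to left. *)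
Lemma transfer_row_eq e : transfer_row D beta e = transfer_row D beta' e.
Proof.
suff H d : forall e, (k <= erow e + d)%N -> transfer_row D beta e = transfer_row D beta' e.
  by apply: (H k); lia.
have no_cell f : ~~ (ecol f < row_len lam (erow f))%N ->
    transfer_row D beta f = transfer_row D beta' f.
  by move=> nf; rewrite !(transfer_row_no_cell D _ hkn nf).
elim: d => [|d IHd] {}e hd.
  apply: no_cell; apply/negP => lt_e.
  by have /row_len_gt0 : (0 < row_len lam (erow e))%N by [lia]; lia.
suff H m f : (k <= erow f + d.+1)%N -> (n - k <= ecol f + m)%N ->
    transfer_row D beta f = transfer_row D beta' f.
  by apply: (H (n - k)%N); lia.
elim: m f {e hd} => [|m IHm] e hd hm.
  by apply: no_cell; have := row_len_le lam (erow e); lia.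
have [/nw_of_exists[b be]|ne] := boolP (ecol e < row_len lam (erow e))%N; last exact: no_cell.
move: (be); rewrite nw_ofE => /andP[/eqP rE /eqP cE].
apply: (@transfer_row_nw_eq b _ _ _ _ _ e be).
- by apply: IHm; rewrite /= ?/bump /=; lia.
- by apply: IHd; rewrite /= ?/bump /=; lia.
- rewrite /corner_span; apply: eq_bigr => f fc; congr (<[_]>)%VS; apply: IHd.
  by case: f fc => -[r c] /=; lia.
- by rewrite !corner_span_rows.
- by apply: strict; apply: ltn_ord.
Qed.

End Uniqueness.

(** * The parametrization *)

Lemma restricted_path_matrix_realizes (F : fieldType) k n (hkn : (k <= n)%N)
    (lam : box_partition k n) (D : pipe_dream lam) (hD : go_diagram D)
    (w : 'I_#|cell lam| -> cell lam) (hw : reading_word w) (M : 'M[F]_(k, n)) :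
  restricted_path_matrices D hkn M ->
  exists V : grassmannian F k n, deodhar_component D w hkn V /\ realizes M V.
Proof.
case=> beta [beta_adm ->].
have dimP := dim_span_rows hkn hD hw beta.
exists (exist _ <<rows (path_matrix D beta hkn)>>%VS (introT eqP dimP)); split.
  exists (deodhar_prod D (regauge D w beta) (word w)); split.
    exists (regauge D w beta); split; last by rewrite deodhar_products_word.
    by move=> b sD; rewrite regauge_neq0; have := beta_adm b; rewrite sD.
  by rewrite (span_rows_deodhar hkn hD hw).
exact: (path_matrix_basis hkn hD hw).
Qed.

Lemma deodhar_point_realized (F : fieldType) k n (hkn : (k <= n)%N)
    (lam : box_partition k n) (D : pipe_dream lam) (hD : go_diagram D)
    (w : 'I_#|cell lam| -> cell lam) (hw : reading_word w)
    (V : grassmannian F k n) :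
  deodhar_component D w hkn V ->
  exists M, restricted_path_matrices D hkn M /\ realizes M V.
Proof.
case=> g [[par [par_neq0 ->]] VE].
(* At a white stone the factor ignores its parameter, while the jump parameter
   has to vanish. *)
pose beta b := if symbol_at D b is White then 0 else regauge D w par b.
have regauge_beta b : symbol_at D b <> White -> regauge D w beta b = par b.
  by move=> nW; rewrite -[RHS](regaugeK D w) /regauge /beta; case: symbol_at nW.
have betaE : deodhar_prod D (regauge D w beta) (word w) = deodhar_prod D par (word w).
  apply: eq_bigr => b _; rewrite /deodhar_factor.
  by case sD: (symbol_at D b) => //; rewrite regauge_beta ?sD.
exists (path_matrix D beta hkn); split.
  exists beta; split=> // b; rewrite /beta; have := @par_neq0 b.
  by case: symbol_at => // /(_ erefl); rewrite regauge_neq0.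
rewrite /realizes VE deodhar_products_word -betaE.
rewrite (span_rows_deodhar hkn hD hw); exact: (path_matrix_basis hkn hD hw).
Qed.

Lemma restricted_path_matrix_inj (F : fieldType) k n (hkn : (k <= n)%N)
    (lam : box_partition k n) (D : pipe_dream lam) (hD : go_diagram D)
    (w : 'I_#|cell lam| -> cell lam) (hw : reading_word w)
    (V : grassmannian F k n) (M M' : 'M[F]_(k, n)) :
  restricted_path_matrices D hkn M -> restricted_path_matrices D hkn M' ->
  realizes M V -> realizes M' V -> M = M'.
Proof.
case=> beta [beta_adm ->] [beta' [beta'_adm ->]] /span_basis MV /span_basis M'V.
have neq0 (gam : cell lam -> F) : admissible_jumps D gam ->
    forall b, symbol_at D b = Plus -> gam b != 0.
  by move=> gam_adm b sD; have := gam_adm b; rewrite sD.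
apply/row_matrixP => r; rewrite !path_matrix_row.
have strict j : (j < n - k)%N ->
    ~~ (corner_span D beta 0 j.+1 <= corner_span D beta 0 j)%VS.
  exact: (corner_span_strict hkn hD hw).
exact: (transfer_row_eq hD (neq0 _ beta_adm) (neq0 _ beta'_adm) strict (etrans MV (esym M'V))).
Qed.

Theorem theorem3p4 (R : realType) (F : fieldType)
    (hF : F = (R : fieldType) \/ F = (complex R : fieldType))
    (k n : nat) (hkn : (k <= n)%N) (lam : box_partition k n)
    (D : pipe_dream lam) (hD : go_diagram D)
    (w : 'I_#|cell lam| -> cell lam) (hw : reading_word w) :
  (forall M : 'M[F]_(k, n), restricted_path_matrices D hkn M ->
     exists V : grassmannian F k n,
       deodhar_component D w hkn V /\ realizes M V) /\
  (forall V : grassmannian F k n, deodhar_component D w hkn V ->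
     exists! M : 'M[F]_(k, n),
       restricted_path_matrices D hkn M /\ realizes M V).
Proof.
split=> [M|V VD]; first exact: restricted_path_matrix_realizes.
have [M [MR MV]] := deodhar_point_realized hD hw VD.
exists M; split=> // M' [M'R M'V].
exact: (restricted_path_matrix_inj hD hw MR M'R MV M'V).
Qed.
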